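(* Let $m\in\mathbb N$, $q\in(0,1)$, $k_1\ge k_2\ge\dots\ge k_m>0$ be real numbers, and let $E=E(k_1,\ldots,k_m;q)$ be the achievement set of the corresponding multigeometric sequence. If $E$ is a Cantorval, then the boundary of $E$ in $\mathbb R$ has Lebesgue measure zero.
   Context: $\mathbb N=\{1,2,3,\dots\}$. For a sequence $(x_n)_{n\in\mathbb N}$ of non-negative real numbers with $\sum x_n<\infty$, the achievement set is $E(x_n)=\{y\in\mathbb R:\ \exists A\subset\mathbb N,\ y=\sum_{n\in A}x_n\}$ (the empty sum is $0$). Multigeometric sequence: given $m\in\mathbb N$, $q\in(0,1)$ and $k_1\ge\dots\ge k_m>0$, it is the sequence $(a_n)_{n\in\mathbb N}$ with $a_n=k_iq^j$, where $(j,i)$ is the unique pair with $j\in\mathbb N$, $i\in\{1,\dots,m\}$ and $n=(j-1)m+i$. Its achievement set is denoted $E(k_1,\dots,k_m;q)$. For a closed set $A\subset\mathbb R$, the bounded components of $\mathbb R\setminus A$ are called $A$-gaps and the non-trivial (i.e. not one-point) components of $A$ are called $A$-intervals. A Cantorval is a non-empty compact set $A\subset\mathbb R$ having at least one $A$-gap, such that every endpoint of an $A$-gap is simultaneously the limit of a sequence of $A$-gaps and of a sequence of $A$-intervals. *)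

(* Defs.v *)
From HB Require Import structures.
From mathcomp Require Import all_boot all_order all_algebra.
From mathcomp Require Import all_classical all_reals all_analysis.

Set Implicit Arguments.
Unset Strict Implicit.
Unset Printing Implicit Defensive.

Import Order.TTheory GRing.Theory Num.Theory.
Import numFieldNormedType.Exports.

Local Open Scope classical_set_scope.
Local Open Scope ring_scope.

(* Intended for non-negative summable x. *)
Definition achievement_set {R : realType} (x : nat -> R) : set R :=
  [set y | exists A : set nat, y%:E = (\esum_(n in A) (x n)%:E)%E].

(* Sequences start at index 0 here: in the usual numbering from 1, the term of
   index n.+1 = (j - 1) * m + i is k_i q^j with j = n %/ m + 1 and
   i = n %% m + 1; k_i is the entry of k at position i - 1. *)
Definition multigeometric {R : realType} {m : nat} (k : m.-tuple R) (q : R) :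
    nat -> R :=
  fun n => k`_(n %% m) * q ^+ (n %/ m).+1.

Definition is_component {T : topologicalType} (A C : set T) : Prop :=
  exists2 x, A x & C = connected_component A x.

Definition is_gap {R : realType} (A G : set R) : Prop :=
  is_component (~` A) G /\ bounded_set G.

Definition is_nontrivial_component {R : realType} (A I : set R) : Prop :=
  is_component A I /\ exists x y, [/\ I x, I y & x != y].

(* To be used for bounded non-empty intervals C, where inf and sup are the
   genuine ones. *)
Definition is_endpoint {R : realType} (C : set R) (x : R) : Prop :=
  x = inf C \/ x = sup C.

(* The sets S n shrink to the point x; in particular their diameters tend to 0,
   so a constant sequence of non-degenerate intervals does not qualify. *)
Definition sets_converge_to {T : topologicalType} (S : nat -> set T) (x : T) :
    Prop :=
  forall U, nbhs x U -> \forall n \near \oo, S n `<=` U.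

Definition is_cantorval {R : realType} (A : set R) : Prop :=
  [/\ A !=set0, compact A, (exists G, is_gap A G) &
    forall G x, is_gap A G -> is_endpoint G x ->
      (exists S, (forall n, is_gap A (S n)) /\ sets_converge_to S x) /\
      (exists S, (forall n, is_nontrivial_component A (S n)) /\
                 sets_converge_to S x)].

Definition boundary {T : topologicalType} (A : set T) : set T :=
  closure A `\` interior A.

(* Main.v *)
Require Import Defs.
From mathcomp Require Import all_boot all_order all_algebra.
From mathcomp Require Import all_classical all_reals all_analysis.
From mathcomp Require Import measurable_realfun ring lra.
Import Order.TTheory GRing.Theory Num.Theory.
Import numFieldNormedType.Exports.
Local Open Scope classical_set_scope.
Local Open Scope ring_scope.

(* Every point of E lies in a translate of q^n E contained in E. Since a
   Cantorval contains an interval, the boundary of E is porous: near each of its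
   points, at each scale q^n, a fixed proportion of the ball is occupied by the
   interior of E. So no point of the boundary is a Lebesgue density point. *)

(** The hole takes length [c * r n] out of a ball of length [2 * r n], so along the radii [r n] the
    density of [D] at each of its points is at most [1 - c / 2]. By the Lebesgue density theorem it
    tends to 1 at almost every point of [D]. *)
Lemma porous_measure0 (R : realType) (D : set R) (c : R) (r : nat -> R) :
    measurable D -> 0 < c -> (forall n, 0 < r n) -> r @ \oo --> 0 ->
    (forall x n, D x -> exists a,
       `]a, a + c * r n[ `<=` ball x (r n) `\` D) ->
  lebesgue_measure D = 0%E.
Proof.
move=> mD c0 r0 rcvg porous.
have bound (x : R) n : D x ->
    (lebesgue_measure (D `&` ball x (r n)) <= (r n *+ 2 - c * r n)%:E)%E.
  move=> Dx; have [a aD] := porous x n Dx.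
  have mDb : measurable (D `&` ball x (r n)).
    by apply: measurableI => //; exact: measurable_ball.
  have aE : lebesgue_measure (`]a, a + c * r n[ : set R) = (c * r n)%:E.
    rewrite lebesgue_measure_itv/= lte_fin ltrDl mulr_gt0//.
    by rewrite -EFinD addrAC subrr add0r.
  rewrite EFinB leeBrDr// -aE -(lebesgue_measure_ball x (ltW (r0 n))).
  rewrite -measureU//=; last by apply/seteqP; split=> // z [[Dz _]] /aD [].
  apply: le_measure; rewrite ?inE; [exact: measurableU|exact: measurable_ball|].
  by move=> z [[]//|/aD []].
(* The density theorem takes its limit over positive radii, hence the one-sided filter. *)
have rcvg' : r @ \oo --> 0^'+.
  move=> U U0.
  have : \forall n \near \oo, 0 < r n -> U (r n) := rcvg _ U0.
  by apply: (@filterS _ \oo) => n; apply; exact: r0.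
apply: measure_negligible => //.
have density := lebesgue_density mD.
apply: (negligibleS _ density) => x Dx /= dens.
have {}dens := cvg_comp _ _ rcvg' dens; rewrite indicE mem_set//= in dens.
suff : ((1%R : R)%:E <= (1 - c / 2)%:E)%E by rewrite lee_fin; lra.
apply: (cvge_to_le dens); near=> n => /=.
rewrite lebesgue_measure_ball ?(ltW (r0 n))// inver mulrn_eq0/= gt_eqF//.
have -> : 1 - c / 2 = (r n *+ 2 - c * r n) * (r n *+ 2)^-1.
  by rewrite -mulr_natr; field; rewrite gt_eqF.
rewrite EFinM lee_wpmul2r ?bound//.
by rewrite lee_fin invr_ge0 mulrn_wge0// ltW.
Unshelve. all: by end_near.
Qed.

Lemma esumZl (R : realType) (T : choiceType) (A : set T) (p : R)
    (f : T -> \bar R) : 0 < p -> (forall i, (0 <= f i)%E) ->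
  (\esum_(i in A) (p%:E * f i) = p%:E * \esum_(i in A) f i)%E.
Proof.
move=> p0 f0; rewrite /esum -ereal_sup_pZl//; congr ereal_sup.
by rewrite image_comp; apply: eq_imagel => B _ /=; rewrite ge0_mule_fsumr.
Qed.

(** Split the index set of [y] at [N]. The head sums to [t]; the tail, shifted back by [N], gives a
    point [e] scaled by [p]. Keeping the head and varying the tail gives the whole copy. *)
Lemma achievement_set_copy (R : realType) (x : nat -> R) (N : nat) (p y : R) :
    (forall n, 0 <= x n) -> 0 < p -> (forall n, x (n + N)%N = p * x n) ->
    achievement_set x y ->
  exists t, (forall e, achievement_set x e -> achievement_set x (t + p * e)) /\
    (exists2 e, achievement_set x e & y = t + p * e).
Proof.
move=> x_ge0 p0 xp [A yE].
have x0 n : (0 <= (x n)%:E)%E by rewrite lee_fin.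
pose H := [set n | (n < N)%N] : set nat.
pose sh (B : set nat) := [set (n + N)%N | n in B].
have esum_sh B : (\esum_(n in sh B) (x n)%:E =
    p%:E * \esum_(n in B) (x n)%:E)%E.
  rewrite esum_image; last by move=> i j _ _ /addIn.
  by rewrite -esumZl//; apply: eq_esum => n _; rewrite xp EFinM.
have shH B : sh B `<=` ~` H.
  by move=> _ [n _ <-]; apply/negP; rewrite -leqNgt leq_addl.
pose A' := [set n | A (n + N)%N] : set nat.
have AE : A `&` ~` H = sh A'.
  apply/seteqP; split=> [n /= [An /negP]|_ [n An <-]]; last first.
    by split=> //; apply: shH; exists n.
  by rewrite -leqNgt => Nn; exists (n - N)%N; rewrite /A' /= subnK.
have esumH B : (\esum_(n in B) (x n)%:E =
    \esum_(n in B `&` H) (x n)%:E + \esum_(n in B `&` ~` H) (x n)%:E)%E.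
  exact: esumID.
rewrite esumH AE esum_sh in yE.
(* Since [y] is real, both summands are finite; as [p] is positive, the sum over [A'] is then finite
   too. *)
have : (\esum_(n in A `&` H) (x n)%:E +
    p%:E * (\esum_(n in A') (x n)%:E) \is a fin_num)%E by rewrite -yE.
rewrite fin_numD => /andP[/EFin_fin_numP[t tE]].
case eE : (\esum_(n in A') (x n)%:E)%E => [e| |] //=; last 2 first.
- by rewrite gt0_muley ?lte_fin.
- by rewrite gt0_muleNy ?lte_fin.
move=> _; rewrite tE eE -EFinM -EFinD in yE.
exists t; split; last by exists e; [exists A'; rewrite eE|case: yE].
(* The head of [A] is kept and its tail replaced by the shift of [B]. *)
move=> e' [B BE]; exists (A `&` H `|` sh B).
rewrite esumH EFinD EFinM -tE BE -esum_sh.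
have -> : (A `&` H `|` sh B) `&` H = A `&` H.
  rewrite setIUl -setIA setIid (_ : sh B `&` H = set0) ?setU0//.
  by apply/seteqP; split=> // n [/shH].
have -> // : (A `&` H `|` sh B) `&` ~` H = sh B.
by rewrite setIUl -setIA setICr setI0 set0U; apply/setIidPl/shH.
Qed.

(** An endpoint of a gap is a limit of non-trivial components. Any one of them is connected, so it
    contains the open interval between two of its points. *)
Lemma cantorval_interior (R : realType) (E : set R) :
  is_cantorval E -> exists u v : R, u < v /\ `]u, v[ `<=` E°.
Proof.
case=> _ _ [G gapG] /(_ G (inf G) gapG (or_introl erefl)) [_ [S [+ _]]].
move=> /(_ 0%N) [[x Ex ->] [u [v [uC vC uv]]]].
wlog {uv}uv : u v uC vC / u < v.
  by move=> h; move: uv; rewrite neq_lt => /orP[] /h; apply.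
exists u, v; split => //.
have oI : open `]u, v[%classic by exact: interval_open.
rewrite -(open_subsetE _ oI).
move=> z /=; rewrite in_itv/= => /andP[uz zv].
apply: (@connected_component_sub _ _ x).
have /connected_intervalP := @component_connected _ E x.
by apply; [exact: uC|exact: vC|rewrite !ltW].
Qed.

Lemma compact_norm_le (R : realType) (E : set R) :
  compact E -> exists2 M : R, 0 < M & forall x, E x -> `|x| <= M.
Proof.
move=> /compact_bounded [M [_ EM]]; exists (`|M| + 1); first by rewrite ltr_wpDl.
by move=> x; apply: EM; rewrite (le_lt_trans (ler_norm M))// ltrDl.
Qed.

Theorem theorem4 (R : realType) (m : nat) (k : m.-tuple R) (q : R)
    (m_gt0 : (0 < m)%N) (q_gt0 : 0 < q) (q_lt1 : q < 1)
    (k_noninc : sorted >=%R k) (k_last_gt0 : 0 < k`_m.-1) :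
  is_cantorval (achievement_set (multigeometric k q)) ->
  lebesgue_measure (boundary (achievement_set (multigeometric k q))) = 0%E.
Proof.
set x := multigeometric k q; set E := achievement_set x => cE.
have k_ge0 i : (i < m)%N -> 0 <= k`_i.
  move=> im; apply/ltW/(lt_le_trans k_last_gt0).
  by apply: (sorted_leq_nth ge_trans ge_refl _ k_noninc);
     rewrite ?inE ?size_tuple ?ltn_predL// -ltnS prednK.
have x_ge0 n : 0 <= x n.
  by rewrite mulr_ge0 ?k_ge0 ?ltn_mod// exprn_ge0// ltW.
(* A shift by [j] full periods scales the sequence by [q ^+ j], which yields copies of [E] at every
   scale. *)
have xM j n : x (n + j * m)%N = q ^+ j * x n.
  by rewrite /x /multigeometric addnC modnMDl divnMDl// -addnS exprD mulrCA.
have [_ compactE _ _] := cE.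
have [u [v [uv uvE]]] := cantorval_interior _ _ cE.
have [M M_gt0 EM] := compact_norm_le _ _ compactE.
have closedE : closed E.
  by apply: compact_closed compactE; exact: Rhausdorff.
have sM : 0 < 2 * M + 1 by lra.
(* Two points of a copy of [E] at scale [q ^+ n] are at most [q ^+ n * (2 * M)] apart; the added 1
   puts the copy inside the open ball. The constant is chosen so that the hole has length
   [q ^+ n * (v - u)], that of the copied interval. *)
apply: (@porous_measure0 _ _ ((v - u) / (2 * M + 1))
          (fun n => q ^+ n * (2 * M + 1))).
- apply: measurableD; first by apply: closed_measurable; exact: closed_closure.
  by apply: open_measurable; exact: open_interior.
- by rewrite divr_gt0// subr_gt0.
- by move=> n; rewrite mulr_gt0// exprn_gt0.
- rewrite -[X in _ --> X](mul0r (2 * M + 1)); apply: cvgMr_tmp.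
  by apply: cvg_expr; rewrite gtr0_norm.
move=> y n [/(closedE _) Ey _].
have qn_gt0 : 0 < q ^+ n by rewrite exprn_gt0.
have [t [tE [e Ee ->]]] :=
  achievement_set_copy _ _ _ _ _ x_ge0 qn_gt0 (xM n) Ey.
have copy z : `]t + q ^+ n * u, t + q ^+ n * v[%classic z ->
    exists2 w, E w & z = t + q ^+ n * w.
  rewrite /= in_itv/= => /andP[uz zv].
  exists ((z - t) / q ^+ n); last first.
    by rewrite mulrCA divff ?gt_eqF// mulr1 addrC subrK.
  apply: interior_subset; apply: uvE.
  by rewrite /= in_itv/= ltr_pdivlMr// ltr_pdivrMr//; apply/andP; split; lra.
(* The copied interval is open and contained in [E], so it misses the boundary. *)
have copyE : `]t + q ^+ n * u, t + q ^+ n * v[%classic `<=` E°.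
  have copy_open : open `]t + q ^+ n * u, t + q ^+ n * v[%classic.
    exact: interval_open.
  rewrite -(open_subsetE _ copy_open) => _ /copy[w Ew ->].
  exact: tE.
exists (t + q ^+ n * u).
rewrite mulrCA divfK ?gt_eqF// -addrA -mulrDr (addrC u) subrK => z cz.
split; last by move=> [_]; apply; exact: copyE.
(* The centre and [z] lie in the same copy, so their distance is [q ^+ n] times that of [e] and
   [w]. *)
have [w Ew ->] := copy z cz.
rewrite /ball/= opprD addrACA subrr add0r -mulrBr normrM gtr0_norm// ltr_pM2l//.
have := EM _ Ew; have := EM _ Ee; have := ler_normB e w; lra.
Qed.
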